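(* Let $G_i=(V_i,E_i)$, $i=1,2$, be finite undirected simple unweighted $D$-regular graphs with signatures $\sigma_i:E_i^{or}\to H_i$, where either $H_i=O(d_i)$ for $i=1,2$ or $H_i=U(d_i)$ for $i=1,2$. If $G_1$ with $\sigma_1$ satisfies $CD^{\sigma_1}(K_1,\infty)$ and $G_2$ with $\sigma_2$ satisfies $CD^{\sigma_2}(K_2,\infty)$, where $K_1,K_2\in\mathbb{R}$, then the Cartesian product graph $G_1\times G_2$ with the signature $\widehat\sigma_{12}$ satisfies $$CD^{\widehat\sigma_{12}}\left(\tfrac12\min\{K_1,K_2\},\infty\right).$$
   Context: Let $D\ge1$. For a finite undirected simple graph $G=(V,E)$ that is $r$-regular ($r\geq 1$), write $x\sim y$ if $\{x,y\}\in E$ and $E^{or}=\{(x,y),(y,x)\mid\{x,y\}\in E\}$. Let $H=O(d)$, $\mathbb{K}=\mathbb{R}$ or $H=U(d)$, $\mathbb{K}=\mathbb{C}$. A signature is a map $\sigma:E^{or}\to H$ with $\sigma_{yx}=\sigma_{xy}^{-1}$. For $u:V\to\mathbb{K}$ put $\Delta u(x)=\frac1r\sum_{y\sim x}(u(y)-u(x))$; for $f:V\to\mathbb{K}^d$ put $\Delta^\sigma f(x)=\frac1r\sum_{y\sim x}(\sigma_{xy}f(y)-f(x))$. Define $2\Gamma^\sigma(f,g)=\Delta(f^T\overline g)-f^T(\overline{\Delta^\sigma g})-(\Delta^\sigma f)^T\overline g$ and $2\Gamma_2^\sigma(f,g)=\Delta\Gamma^\sigma(f,g)-\Gamma^\sigma(f,\Delta^\sigma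 g)-\Gamma^\sigma(\Delta^\sigma f,g)$. $CD^\sigma(K,\infty)$ means $\Gamma_2^\sigma(f,f)(x)\ge K\,\Gamma^\sigma(f,f)(x)$ for all $f:V\to\mathbb{K}^d$, $x\in V$. The Cartesian product $G_1\times G_2=(V_1\times V_2,E_{12})$ has $(x_1,y_1)$ and $(x_2,y_2)$ adjacent iff either $\{x_1,x_2\}\in E_1$ and $y_1=y_2$, or $x_1=x_2$ and $\{y_1,y_2\}\in E_2$; it is $2D$-regular, so on it $\Delta u(p)=\frac1{2D}\sum_{q\sim p}(u(q)-u(p))$ for $u:V_1\times V_2\to\mathbb{K}$ and $\Delta^{\widehat\sigma_{12}}f(p)=\frac1{2D}\sum_{q\sim p}(\widehat\sigma_{12,pq}f(q)-f(p))$ for $f:V_1\times V_2\to\mathbb{K}^{d_1d_2}$, where $p,q\in V_1\times V_2$; with these two operators, $2\Gamma^{\widehat\sigma_{12}}(f,g)=\Delta(f^T\overline g)-f^T(\overline{\Delta^{\widehat\sigma_{12}} g})-(\Delta^{\widehat\sigma_{12}} f)^T\overline g$ and $2\Gamma_2^{\widehat\sigma_{12}}(f,g)=\Delta\Gamma^{\widehat\sigma_{12}}(f,g)-\Gamma^{\widehat\sigma_{12}}(f,\Delta^{\widehat\sigma_{12}} g)-\Gamma^{\widehat\sigma_{12}}(\Delta^{\widehat\sigma_{12}} f,g)$, and $CD^{\widehat\sigma_{12}}(K,\infty)$ means $\Gamma_2^{\widehat\sigma_{12}}(f,f)(p)\ge K\,\Gamma^{\widehat\sigma_{12}}(f,f)(p)$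 for all $f:V_1\times V_2\to\mathbb{K}^{d_1d_2}$, $p\in V_1\times V_2$. The signature $\widehat\sigma_{12}$ takes values in $H_1\otimes H_2\subset O(d_1d_2)$ (resp. $U(d_1d_2)$): $\widehat\sigma_{12,(x_1,y)(x_2,y)}=\sigma_{1,x_1x_2}\otimes \mathrm{I}_{d_2}$ for $(x_1,x_2)\in E_1^{or}$, $y\in V_2$, and $\widehat\sigma_{12,(x,y_1)(x,y_2)}=\mathrm{I}_{d_1}\otimes\sigma_{2,y_1y_2}$ for $(y_1,y_2)\in E_2^{or}$, $x\in V_1$, where $\mathrm{I}_{d_i}$ is the $d_i\times d_i$ identity matrix. *)

(* Defs.v *)
From HB Require Import structures.
From mathcomp Require Import all_boot all_order all_algebra.
From mathcomp Require Import reals complex mxtens.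

Set Implicit Arguments.
Unset Strict Implicit.
Unset Printing Implicit Defensive.

Import Order.TTheory GRing.Theory Num.Theory.

Local Open Scope ring_scope.

Definition simple_graph (V : finType) (e : rel V) : Prop :=
  symmetric e /\ irreflexive e.

Definition regular_graph (V : finType) (e : rel V) (r : nat) : Prop :=
  forall x : V, #|[set y | e x y]| = r.

Definition cartesian_edge (V1 V2 : finType) (e1 : rel V1) (e2 : rel V2) :
    rel (V1 * V2)%type :=
  fun p q => (e1 p.1 q.1 && (p.2 == q.2)) || ((p.1 == q.1) && e2 p.2 q.2).

Definition orthogonal_group (R : realType) (d : nat) : {pred 'M[R]_d} :=
  [pred A | A *m A^T == 1%:M].

Definition unitary_group (R : realType) (d : nat) : {pred 'M[R[i]]_d} :=
  [pred A | A \is unitarymx].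

(* A map on oriented edges is encoded as a total function on V * V whose values
   off the edges are unconstrained and never used. *)
Definition is_signature (K : fieldType) (V : finType) (e : rel V) (d : nat)
    (H : {pred 'M[K]_d}) (s : V -> V -> 'M[K]_d) : Prop :=
  forall x y : V, e x y -> s x y \in H /\ s y x = invmx (s x y).

(* The first branch is the edges inside a copy of V1, the second those inside a
   copy of V2: adjacent p and q agree in exactly one coordinate.
   [*t] is the Kronecker product. *)
Definition product_signature (K : fieldType) (V1 V2 : finType) (d1 d2 : nat)
    (s1 : V1 -> V1 -> 'M[K]_d1) (s2 : V2 -> V2 -> 'M[K]_d2)
    (p q : (V1 * V2)%type) : 'M[K]_(d1 * d2) :=
  if p.2 == q.2 then s1 p.1 q.1 *t 1%:M else 1%:M *t s2 p.2 q.2.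

(* [cj] is the conjugation of the scalar field: the identity for the reals,
   complex conjugation for R[i]. [r] is the degree of the graph. *)
Section BakryEmery.
Variables (K : numFieldType) (cj : K -> K).
Variables (V : finType) (e : rel V) (r : nat).

Definition laplacian (u : V -> K) (x : V) : K :=
  r%:R^-1 * \sum_(y | e x y) (u y - u x).

Variables (d : nat) (s : V -> V -> 'M[K]_d).

Definition connection_laplacian (f : V -> 'cV[K]_d) (x : V) : 'cV[K]_d :=
  r%:R^-1 *: \sum_(y | e x y) (s x y *m f y - f x).

Definition pairing (f g : V -> 'cV[K]_d) (x : V) : K :=
  ((f x)^T *m map_mx cj (g x)) ord0 ord0.

Definition Gamma (f g : V -> 'cV[K]_d) (x : V) : K :=
  2^-1 * (laplacian (pairing f g) x
          - pairing f (connection_laplacian g) x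
          - pairing (connection_laplacian f) g x).

Definition Gamma2 (f g : V -> 'cV[K]_d) (x : V) : K :=
  2^-1 * (laplacian (Gamma f g) x
          - Gamma f (connection_laplacian g) x
          - Gamma (connection_laplacian f) g x).

(* Over R[i], [a <= b] means that b - a is a nonnegative real number. Both sides
   below are real there when [k] is real, so this is the usual inequality. *)
Definition CD (k : K) : Prop :=
  forall (f : V -> 'cV[K]_d) (x : V), k * Gamma f f x <= Gamma2 f f x.

End BakryEmery.

Lemma cartesian_edge_simple (V1 V2 : finType) (e1 : rel V1) (e2 : rel V2) :
  simple_graph e1 -> simple_graph e2 -> simple_graph (cartesian_edge e1 e2).
Proof.
move=> [s1 i1] [s2 i2]; split=> [p q|p]; rewrite /cartesian_edge.
  by rewrite s1 s2 (eq_sym p.1) (eq_sym p.2).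
by rewrite i1 i2 andbF.
Qed.

Lemma cartesian_edge_regular (V1 V2 : finType) (e1 : rel V1) (e2 : rel V2)
    (D : nat) :
  simple_graph e1 -> simple_graph e2 ->
  regular_graph e1 D -> regular_graph e2 D ->
  regular_graph (cartesian_edge e1 e2) (2 * D).
Proof.
move=> [_ i1] [_ i2] r1 r2 [x y].
have -> : [set q | cartesian_edge e1 e2 (x, y) q] =
  setX [set z | e1 x z] [set y] :|: setX [set x] [set z | e2 y z].
  by apply/setP=> -[a b]; rewrite !inE /cartesian_edge /= (eq_sym y) (eq_sym x).
rewrite cardsU !cardsX !cards1 r1 r2 muln1 mul1n mul2n -addnn.
rewrite (_ : _ :&: _ = set0) ?cards0 ?subn0 //.
apply/setP=> -[a b]; rewrite !inE /=; apply/negP=> /andP[/andP[h _] /andP[/eqP xa _]].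
by rewrite xa i1 in h.
Qed.

Lemma product_signatureE1 (K : fieldType) (V1 V2 : finType) (d1 d2 : nat)
    (s1 : V1 -> V1 -> 'M[K]_d1) (s2 : V2 -> V2 -> 'M[K]_d2) x1 x2 y :
  product_signature s1 s2 (x1, y) (x2, y) = s1 x1 x2 *t 1%:M.
Proof. by rewrite /product_signature eqxx. Qed.

Lemma product_signatureE2 (K : fieldType) (V1 V2 : finType) (e2 : rel V2)
    (d1 d2 : nat) (s1 : V1 -> V1 -> 'M[K]_d1) (s2 : V2 -> V2 -> 'M[K]_d2)
    x y1 y2 : simple_graph e2 -> e2 y1 y2 ->
  product_signature s1 s2 (x, y1) (x, y2) = 1%:M *t s2 y1 y2.
Proof.
move=> [_ i2] h; rewrite /product_signature /=.
by case: eqP => // y12; rewrite y12 i2 in h.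
Qed.

(* Main.v *)
Require Import Defs.
From mathcomp Require Import all_boot all_order all_algebra.
From mathcomp Require Import reals complex mxtens boolp ring.

(** The proof rests on the identity, for the product operators
    [Gamma] and [Gamma2] and the factor operators [Gamma^(i)], [Gamma2^(i)],
    each applied in its own variable:

      Gamma         = 1/2 (Gamma^(1) + Gamma^(2)),
      Gamma2 (f, f) = 1/4 (Gamma2^(1) (f, f) + Gamma2^(2) (f, f))
                      + 1/8 (M^(12) f + M^(21) f),

    where the mixed term [M^(12) f] is the expression defining [2 Gamma2], with
    the outer Laplacian taken in one variable and the inner [Gamma] in the
    other ([Gamma2_product]).  If the mixed terms are nonnegative, the
    curvature bounds of the factors give
    Gamma2 >= 1/4 min(K1, K2) (Gamma^(1) + Gamma^(2)) = 1/2 min(K1, K2) Gamma.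

    Mixed terms are nonnegative because signatures are isometric: the cross
    terms in the definition of [Gamma] then cancel and leave an average of
    squared differences along edges ([GammaE]).  The difference of f along a
    fixed edge of the inner graph is a function h on the outer graph, and taking
    it commutes with the outer connection Laplacian, since the two signatures
    commute.  So the contribution of that edge to the mixed term is a positive
    multiple of [Gamma (h, h)] on the outer graph ([mixed_Gamma2E]).

    This argument takes place in one fibre space of dimension d1 * d2, on which
    the factor signatures act as s1 (x) 1 and 1 (x) s2.  They inherit the
    curvature bounds of s1 and s2 because the fibre splits into copies of the
    small fibre: each slice of a tensor intertwines the two signatures, and
    squared norms, hence [Gamma] and [Gamma2], are the sums of the
    contributions of the slices ([CD_intertwined]).

    Both scalar fields are treated at once: a ring endomorphism [cj] with
    z * cj z >= 0 stands for the identity or for complex conjugation. *)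

Import Order.TTheory GRing.Theory Num.Theory.

Local Open Scope ring_scope.
Local Open Scope complex_scope.

(** * The Hermitian form on the fibres *)

Section Dot.
Context {K : numFieldType} (cj : {rmorphism K -> K}).

Definition dot {d} (a b : 'cV[K]_d) : K := (a^T *m map_mx cj b) ord0 ord0.

Lemma dotE d (a b : 'cV_d) : dot a b = \sum_i a i ord0 * cj (b i ord0).
Proof. by rewrite /dot !mxE; apply: eq_bigr => i _; rewrite !mxE. Qed.

Lemma dotBl d (a b c : 'cV_d) : dot (a - b) c = dot a c - dot b c.
Proof. by rewrite /dot linearB /= mulmxBl !mxE. Qed.

Lemma dotBr d (a b c : 'cV_d) : dot c (a - b) = dot c a - dot c b.
Proof. by rewrite /dot map_mxB mulmxBr !mxE. Qed.

Lemma dotDl d (a b c : 'cV_d) : dot (a + b) c = dot a c + dot b c.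
Proof. by rewrite /dot linearD /= mulmxDl !mxE. Qed.

Lemma dotDr d (a b c : 'cV_d) : dot c (a + b) = dot c a + dot c b.
Proof. by rewrite /dot map_mxD mulmxDr !mxE. Qed.

Lemma dotZl d k (a b : 'cV_d) : dot (k *: a) b = k * dot a b.
Proof. by rewrite /dot linearZ /= -scalemxAl !mxE. Qed.

Lemma dotZr d k (a b : 'cV_d) : dot a (k *: b) = cj k * dot a b.
Proof. by rewrite /dot map_mxZ -scalemxAr !mxE. Qed.

Lemma dot_suml d (I : finType) (P : pred I) (a : I -> 'cV_d) b :
  dot (\sum_(i | P i) a i) b = \sum_(i | P i) dot (a i) b.
Proof. by rewrite /dot linear_sum /= mulmx_suml summxE. Qed.

Lemma dot_sumr d (I : finType) (P : pred I) (a : I -> 'cV_d) b :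
  dot b (\sum_(i | P i) a i) = \sum_(i | P i) dot b (a i).
Proof. by rewrite /dot map_mx_sum mulmx_sumr summxE. Qed.

Lemma cjVnat n : cj n%:R^-1 = n%:R^-1.
Proof. by rewrite fmorphV rmorph_nat. Qed.

Lemma dot_ge0 d (a : 'cV_d) : (forall z, 0 <= z * cj z) -> 0 <= dot a a.
Proof. by move=> cj_ge0; rewrite dotE sumr_ge0. Qed.

End Dot.

(** * Carre du champ of an isometric signature *)

Section OneGraph.
Context {K : numFieldType} (cj : {rmorphism K -> K}).
Context {V : finType} (e : rel V) (r : nat).

Definition isometric {d} (s : V -> V -> 'M[K]_d) : Prop :=
  forall x y a b, e x y -> dot cj (s x y *m a) (s x y *m b) = dot cj a b.

(** Isometry turns <f y, g y> into <s f y, s g y>; the definition is then the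
    expansion of the product of the two differences. *)
Lemma GammaE d (s : V -> V -> 'M[K]_d) (f g : V -> 'cV_d) x :
  isometric s ->
  Gamma cj e r s f g x =
  2^-1 * (r%:R^-1 * \sum_(y | e x y)
    dot cj (s x y *m f y - f x) (s x y *m g y - g x)).
Proof.
move=> iso; rewrite /Gamma /laplacian /connection_laplacian /pairing.
rewrite -!/(dot cj _ _) dotZl dotZr cjVnat dot_suml dot_sumr -!mulrBr -!sumrB.
congr (_ * (_ * _)); apply: eq_bigr => y exy.
rewrite -!/(dot cj _ _) !(dotBl, dotBr) iso //; ring.
Qed.

Section Bilinear.
Context {d : nat} {s : V -> V -> 'M[K]_d} (iso : isometric s).
Implicit Types f g h : V -> 'cV[K]_d.

Lemma Gamma_ge0 f x : (forall z, 0 <= z * cj z) -> 0 <= Gamma cj e r s f f x.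
Proof.
move=> cj_ge0; rewrite GammaE // mulr_ge0 ?invr_ge0 ?ler0n // mulr_ge0 //.
  by rewrite invr_ge0 ler0n.
by apply: sumr_ge0 => y _; exact: dot_ge0.
Qed.

Lemma Gamma_linearl k f g h x :
  Gamma cj e r s (fun y => k *: (f y + g y)) h x =
  k * (Gamma cj e r s f h x + Gamma cj e r s g h x).
Proof.
rewrite !GammaE // -!mulrDr -big_split [RHS]mulrCA.
rewrite [X in _ = _ * X]mulrCA [X in _ = _ * (_ * X)]mulr_sumr.
congr (_ * (_ * _)); apply: eq_bigr => y _ /=.
by rewrite -dotDl -dotZl -scalemxAr -scalerBr mulmxDr addrACA opprD.
Qed.

Lemma Gamma_linearr k f g h x :
  Gamma cj e r s h (fun y => k *: (f y + g y)) x =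
  cj k * (Gamma cj e r s h f x + Gamma cj e r s h g x).
Proof.
rewrite !GammaE // -!mulrDr -big_split [RHS]mulrCA.
rewrite [X in _ = _ * X]mulrCA [X in _ = _ * (_ * X)]mulr_sumr.
congr (_ * (_ * _)); apply: eq_bigr => y _ /=.
by rewrite -dotDr -dotZr -scalemxAr -scalerBr mulmxDr addrACA opprD.
Qed.

End Bilinear.

Lemma laplacianD (u v : V -> K) x :
  laplacian e r (fun y => u y + v y) x = laplacian e r u x + laplacian e r v x.
Proof.
rewrite /laplacian -mulrDr -big_split; congr (_ * _).
by apply: eq_bigr => y _ /=; rewrite addrACA opprD.
Qed.

Lemma laplacianZ k (u : V -> K) x :
  laplacian e r (fun y => k * u y) x = k * laplacian e r u x.
Proof.
rewrite /laplacian [RHS]mulrCA [X in _ = _ * X]mulr_sumr; congr (_ * _).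
by apply: eq_bigr => y _; rewrite mulrBr.
Qed.

Lemma laplacian_sum (I : finType) (P : pred I) (u : I -> V -> K) x :
  laplacian e r (fun y => \sum_(i | P i) u i y) x =
  \sum_(i | P i) laplacian e r (u i) x.
Proof.
rewrite /laplacian -mulr_sumr exchange_big; congr (_ * _).
by apply: eq_bigr => y _; rewrite sumrB.
Qed.

(** * Transfer of curvature bounds along intertwining maps *)

(** The maps [P j] cut the fibre of [S] into pieces on each of which [S] acts
    as [s]; Parseval's identity says that nothing is lost and nothing is
    counted twice. *)
Section Intertwining.
Context {J : finType} {d d' : nat} (P : J -> 'M[K]_(d, d')).
Context {s : V -> V -> 'M[K]_d} {S : V -> V -> 'M[K]_d'}.
Hypothesis parseval :
  forall a b, dot cj a b = \sum_j dot cj (P j *m a) (P j *m b).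
Hypothesis intertwines : forall j x y, P j *m S x y = s x y *m P j.

Lemma isometric_intertwined : isometric s -> isometric S.
Proof.
move=> iso x y a b exy; rewrite !parseval; apply: eq_bigr => j _.
by rewrite !mulmxA intertwines -!mulmxA iso.
Qed.

Lemma connection_laplacian_intertwined j (f : V -> 'cV_d') :
  (fun y => P j *m connection_laplacian e r S f y) =
  connection_laplacian e r s (fun y => P j *m f y).
Proof.
apply/funext => x; rewrite /connection_laplacian -scalemxAr mulmx_sumr.
by congr (_ *: _); apply: eq_bigr => y _; rewrite mulmxBr !mulmxA intertwines.
Qed.

Lemma Gamma_intertwined (f g : V -> 'cV_d') x : isometric s ->
  Gamma cj e r S f g x =
  \sum_j Gamma cj e r s (fun y => P j *m f y) (fun y => P j *m g y) x.
Proof.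
move=> iso; rewrite GammaE; last exact: isometric_intertwined.
under [RHS]eq_bigr do rewrite GammaE //.
rewrite -!mulr_sumr exchange_big; congr (_ * (_ * _)).
apply: eq_bigr => y _; rewrite parseval; apply: eq_bigr => j _.
by rewrite !mulmxBr !mulmxA intertwines.
Qed.

(** [Gamma] and [Gamma2] are sums over the pieces, so the bound for [s] can be
    applied to each piece separately. *)
Lemma CD_intertwined k : isometric s -> CD cj e r s k -> CD cj e r S k.
Proof.
move=> iso cd f x.
have -> : Gamma2 cj e r S f f x =
    \sum_j Gamma2 cj e r s (fun y => P j *m f y) (fun y => P j *m f y) x.
  rewrite /Gamma2 -mulr_sumr !sumrB; congr (_ * (_ - _ - _)).
  - rewrite -laplacian_sum; congr (laplacian _ _ _ _).
    by apply/funext => y; rewrite Gamma_intertwined.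
  - rewrite Gamma_intertwined //; apply: eq_bigr => j _.
    by rewrite connection_laplacian_intertwined.
  - rewrite Gamma_intertwined //; apply: eq_bigr => j _.
    by rewrite connection_laplacian_intertwined.
by rewrite Gamma_intertwined // mulr_sumr ler_sum.
Qed.

End Intertwining.

End OneGraph.

Arguments isometric_intertwined {K cj V e J d d' P s S}.
Arguments CD_intertwined {K cj V e r J d d' P s S}.

(** * Slices of a tensor product *)

Section Tensor.
Context {K : numFieldType} (cj : {rmorphism K -> K}).
Context {d1 d2 : nat}.

(** Reading a vector of K^(d1 * d2) as a d1 x d2 matrix, [lslice j] extracts
    column j and [rslice i] extracts row i. *)
Definition lslice (j : 'I_d2) : 'M[K]_(d1, d1 * d2) :=
  \matrix_(i, k) (k == mxtens_index (i, j))%:R.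

Definition rslice (i : 'I_d1) : 'M[K]_(d2, d1 * d2) :=
  \matrix_(j, k) (k == mxtens_index (i, j))%:R.

Lemma lslice_mulE n j (A : 'M[K]_(d1 * d2, n)) i k :
  (lslice j *m A) i k = A (mxtens_index (i, j)) k.
Proof.
rewrite mxE (bigD1 (mxtens_index (i, j))) //= mxE eqxx mul1r big1 ?addr0 //.
by move=> l /negPf; rewrite mxE => ->; rewrite mul0r.
Qed.

Lemma rslice_mulE n i (A : 'M[K]_(d1 * d2, n)) j k :
  (rslice i *m A) j k = A (mxtens_index (i, j)) k.
Proof.
rewrite mxE (bigD1 (mxtens_index (i, j))) //= mxE eqxx mul1r big1 ?addr0 //.
by move=> l /negPf; rewrite mxE => ->; rewrite mul0r.
Qed.

Lemma mxtens_index_eq (p q : 'I_d1 * 'I_d2) :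
  (mxtens_index p == mxtens_index q) = (p == q).
Proof. exact/can_eq/mxtens_indexK. Qed.

Lemma lslice_parseval a b :
  dot cj a b = \sum_j dot cj (lslice j *m a) (lslice j *m b).
Proof.
rewrite dotE (reindex (@mxtens_index d1 d2)) /=; last first.
  exists (@mxtens_unindex d1 d2) => ? _.
    exact: mxtens_indexK.
  exact: mxtens_unindexK.
under [RHS]eq_bigr do rewrite dotE.
rewrite exchange_big pair_bigA; apply: eq_bigr => -[i j] _ /=.
by rewrite !lslice_mulE.
Qed.

Lemma rslice_parseval a b :
  dot cj a b = \sum_i dot cj (rslice i *m a) (rslice i *m b).
Proof.
rewrite dotE (reindex (@mxtens_index d1 d2)) /=; last first.
  exists (@mxtens_unindex d1 d2) => ? _.
    exact: mxtens_indexK.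
  exact: mxtens_unindexK.
under [RHS]eq_bigr do rewrite dotE.
rewrite pair_bigA; apply: eq_bigr => -[i j] _ /=.
by rewrite !rslice_mulE.
Qed.

Lemma lslice_intertwines j (A : 'M[K]_d1) :
  lslice j *m (A *t 1%:M) = A *m lslice j.
Proof.
apply/matrixP => i k; rewrite lslice_mulE.
case: (mxtens_indexP k) => {}k l; rewrite tensmxE !mxE (bigD1 k) //= !mxE.
rewrite big1 ?addr0; last first.
  move=> m mk; rewrite mxE mxtens_index_eq xpair_eqE eq_sym (negPf mk).
  by rewrite mulr0.
by rewrite mxtens_index_eq xpair_eqE eqxx eq_sym.
Qed.

Lemma rslice_intertwines i (B : 'M[K]_d2) :
  rslice i *m (1%:M *t B) = B *m rslice i.
Proof.
apply/matrixP => j k; rewrite rslice_mulE.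
case: (mxtens_indexP k) => {}k l; rewrite tensmxE !mxE (bigD1 l) //= !mxE.
rewrite big1 ?addr0; last first.
  move=> m ml; rewrite mxE mxtens_index_eq xpair_eqE (eq_sym l) (negPf ml).
  by rewrite andbF mulr0.
by rewrite mxtens_index_eq xpair_eqE eqxx andbT eq_sym mulrC.
Qed.

End Tensor.

(** * The mixed term of two commuting signatures *)

Section Mixed.
Context {K : numFieldType} (cj : {rmorphism K -> K}).
Hypothesis cj_ge0 : forall z, 0 <= z * cj z.
Context {V W : finType} (eV : rel V) (eW : rel W) (r : nat) {d : nat}.
Context {t : V -> V -> 'M[K]_d} {u : W -> W -> 'M[K]_d}.
Hypothesis comm_tu : forall x x' y y', t x x' *m u y y' = u y y' *m t x x'.
Hypotheses (isot : isometric cj eV t) (isou : isometric cj eW u).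

(** The expression of [2 * Gamma2], with the outer operators on [V] and the
    inner carre du champ on [W]. *)
Definition mixed_Gamma2 (F : V -> W -> 'cV[K]_d) x y : K :=
  laplacian eV r (fun x' => Gamma cj eW r u (F x') (F x') y) x
  - Gamma cj eW r u (F x)
      (fun y' => connection_laplacian eV r t (F^~ y') x) y
  - Gamma cj eW r u
      (fun y' => connection_laplacian eV r t (F^~ y') x) (F x) y.

(** The difference along the edge from [y] to [y'] commutes with the connection
    Laplacian in the other variable; this is where commutation of the two
    signatures enters. *)
Lemma connection_laplacian_difference (F : V -> W -> 'cV[K]_d) x y y' :
  u y y' *m connection_laplacian eV r t (F^~ y') x
    - connection_laplacian eV r t (F^~ y) x =
  connection_laplacian eV r t (fun x' => u y y' *m F x' y' - F x' y) x.
Proof.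
rewrite /connection_laplacian -scalemxAr mulmx_sumr -scalerBr -sumrB.
congr (_ *: _); apply: eq_bigr => x' _.
rewrite !mulmxBr !mulmxA comm_tu !opprB.
by rewrite addrACA (addrC (- _)) addrACA.
Qed.

(** Expanding the inner [Gamma] into edge differences [h] and moving the outer
    Laplacian through them leaves, for each edge, the definition of
    [2 * Gamma h h]; the 2 cancels the factor 1/2 of the inner [Gamma]. *)
Lemma mixed_Gamma2E (F : V -> W -> 'cV[K]_d) x y :
  mixed_Gamma2 F x y = r%:R^-1 * \sum_(y' | eW y y')
    let h x' := u y y' *m F x' y' - F x' y in Gamma cj eV r t h h x.
Proof.
rewrite /mixed_Gamma2 !GammaE //.
have -> : (fun x' => Gamma cj eW r u (F x') (F x') y) = fun x' =>
    2^-1 * (r%:R^-1 * \sum_(y' | eW y y')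
      dot cj (u y y' *m F x' y' - F x' y) (u y y' *m F x' y' - F x' y)).
  by apply/funext => x'; rewrite GammaE.
rewrite !laplacianZ laplacian_sum -!mulrBr -!sumrB mulrCA.
congr (_ * _); rewrite mulr_sumr; apply: eq_bigr => y' _ /=.
by rewrite connection_laplacian_difference.
Qed.

Lemma mixed_Gamma2_ge0 F x y : 0 <= mixed_Gamma2 F x y.
Proof.
rewrite mixed_Gamma2E mulr_ge0 ?invr_ge0 ?ler0n // sumr_ge0 // => y' _.
exact: Gamma_ge0.
Qed.

End Mixed.

(** * The Cartesian product *)

Section Product.
Context {K : numFieldType} (cj : {rmorphism K -> K}).
Hypothesis cj_ge0 : forall z, 0 <= z * cj z.
Context {V1 V2 : finType} {e1 : rel V1} {e2 : rel V2} (r : nat).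
Hypotheses (simple1 : simple_graph e1) (simple2 : simple_graph e2).

Local Notation e12 := (cartesian_edge e1 e2).

(** A neighbour of (x, y) moves exactly one coordinate: irreflexivity excludes
    the point (x, y) itself, the only one that the two sums could share. *)
Lemma sum_cartesian_edge (M : zmodType) (F : V1 * V2 -> M) x y :
  \sum_(q | e12 (x, y) q) F q =
  \sum_(x' | e1 x x') F (x', y) + \sum_(y' | e2 y y') F (x, y').
Proof.
have [[_ irr1] [_ irr2]] := (simple1, simple2).
rewrite (bigID (fun q : V1 * V2 => q.2 == y)) /=; congr (_ + _).
- rewrite (reindex_onto (fun x' => (x', y)) fst) /=; last first.
    by move=> [x' y'] /andP[_ /eqP /= ->].
  apply: eq_bigl => x'.
  by rewrite /cartesian_edge /= !eqxx irr2 andbF orbF !andbT.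
- rewrite (reindex_onto (fun y' => (x, y')) snd) /=; last first.
    move=> [x' y'] /=; rewrite /cartesian_edge /= (eq_sym y).
    by case: (y' == y); rewrite ?andbF ?andbT //= => /andP[/eqP -> _].
  apply: eq_bigl => y'.
  rewrite /cartesian_edge /= !eqxx irr1 /= andbT.
  by case: eqP => [->|]; rewrite ?irr2 ?andbT.
Qed.

Lemma invr_double : (2 * r)%:R^-1 = 2^-1 * r%:R^-1 :> K.
Proof. by rewrite natrM invfM. Qed.

Lemma laplacian_product (w : V1 * V2 -> K) x y :
  laplacian e12 (2 * r) w (x, y) =
  2^-1 * (laplacian e1 r (fun x' => w (x', y)) x
          + laplacian e2 r (fun y' => w (x, y')) y).
Proof.
by rewrite /laplacian invr_double sum_cartesian_edge -mulrDr mulrA.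
Qed.

Context {d : nat} {t1 : V1 -> V1 -> 'M[K]_d} {t2 : V2 -> V2 -> 'M[K]_d}.
Hypothesis comm12 : forall x x' y y', t1 x x' *m t2 y y' = t2 y y' *m t1 x x'.
Hypotheses (iso1 : isometric cj e1 t1) (iso2 : isometric cj e2 t2).

(** The two signatures share one fibre dimension here; for t1 = s1 (x) 1 and
    t2 = 1 (x) s2 this is convertible to [product_signature s1 s2]. *)
Definition joint_signature (p q : V1 * V2) : 'M[K]_d :=
  if p.2 == q.2 then t1 p.1 q.1 else t2 p.2 q.2.

Local Notation t12 := joint_signature.
Local Notation GammaV1 := (Gamma cj e1 r t1).
Local Notation GammaV2 := (Gamma cj e2 r t2).
Local Notation L1 := (connection_laplacian e1 r t1).
Local Notation L2 := (connection_laplacian e2 r t2).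

Lemma joint_signature1 x x' y : t12 (x, y) (x', y) = t1 x x'.
Proof. by rewrite /t12 /= eqxx. Qed.

Lemma joint_signature2 x y y' : e2 y y' -> t12 (x, y) (x, y') = t2 y y'.
Proof.
have [_ irr2] := simple2.
by rewrite /t12 /=; case: eqP => // ->; rewrite irr2.
Qed.

Lemma connection_laplacian_product (f : V1 * V2 -> 'cV_d) x y :
  connection_laplacian e12 (2 * r) t12 f (x, y) =
  2^-1 *: (L1 (fun x' => f (x', y)) x + L2 (fun y' => f (x, y')) y).
Proof.
rewrite /connection_laplacian invr_double sum_cartesian_edge.
rewrite -scalerDr scalerA; congr (_ *: (_ + _)).
  by apply: eq_bigr => x' _; rewrite joint_signature1.
by apply: eq_bigr => y' ?; rewrite joint_signature2.
Qed.

Lemma Gamma_product (f g : V1 * V2 -> 'cV_d) x y :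
  Gamma cj e12 (2 * r) t12 f g (x, y) =
  2^-1 * (GammaV1 (fun x' => f (x', y)) (fun x' => g (x', y)) x
          + GammaV2 (fun y' => f (x, y')) (fun y' => g (x, y')) y).
Proof.
rewrite /Gamma laplacian_product /pairing.
rewrite !connection_laplacian_product.
rewrite -!/(dot cj _ _) !(dotZl, dotZr, dotDl, dotDr) cjVnat; ring.
Qed.

(** Every operator of the product is the half sum of the two operators of the
    factors, so the expansion has two pure terms and two mixed ones. *)
Lemma Gamma2_product (f : V1 * V2 -> 'cV_d) x y :
  Gamma2 cj e12 (2 * r) t12 f f (x, y) =
  4^-1 * (Gamma2 cj e1 r t1 (fun x' => f (x', y)) (fun x' => f (x', y)) x
    + Gamma2 cj e2 r t2 (fun y' => f (x, y')) (fun y' => f (x, y')) y)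
  + 8^-1 *
    (mixed_Gamma2 cj e1 e2 r (t := t1) (u := t2) (fun x' y' => f (x', y')) x y
    + mixed_Gamma2 cj e2 e1 r (t := t2) (u := t1)
        (fun y' x' => f (x', y')) y x).
Proof.
rewrite /Gamma2 laplacian_product.
under [X in laplacian e1 r X]eq_fun do rewrite Gamma_product.
under [X in laplacian e2 r X]eq_fun do rewrite Gamma_product.
rewrite (laplacianZ e1) (laplacianZ e2) (laplacianD e1) (laplacianD e2).
rewrite !Gamma_product.
have -> : (fun x' => connection_laplacian e12 (2 * r) t12 f (x', y)) =
    fun x' => 2^-1 *:
      (L1 (fun x' => f (x', y)) x' + L2 (fun y' => f (x', y')) y).
  by apply/funext => x'; rewrite connection_laplacian_product.
have -> : (fun y' => connection_laplacian e12 (2 * r) t12 f (x, y')) =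
    fun y' => 2^-1 *:
      (L1 (fun x' => f (x', y')) x + L2 (fun y' => f (x, y')) y').
  by apply/funext => y'; rewrite connection_laplacian_product.
rewrite !Gamma_linearl // !Gamma_linearr // cjVnat /mixed_Gamma2.
by field.
Qed.

(** The bound [k] below both [k1] and [k2] can replace them because [Gamma] is
    nonnegative on each factor. *)
Lemma CD_product k k1 k2 : k <= k1 -> k <= k2 ->
  CD cj e1 r t1 k1 -> CD cj e2 r t2 k2 ->
  CD cj e12 (2 * r) t12 (2^-1 * k).
Proof.
move=> kk1 kk2 cd1 cd2 f [x y]; rewrite Gamma2_product Gamma_product.
set G1 := GammaV1 _ _ x; set G2 := GammaV2 _ _ y.
have -> : 2^-1 * k * (2^-1 * (G1 + G2)) = 4^-1 * (k * G1 + k * G2) + 0.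
  by field.
apply: lerD; last first.
  by rewrite mulr_ge0 ?invr_ge0 ?ler0n // addr_ge0 // mixed_Gamma2_ge0.
rewrite ler_wpM2l ?invr_ge0 ?ler0n //; apply: lerD.
  by apply: le_trans (cd1 _ _); rewrite ler_wpM2r // Gamma_ge0.
by apply: le_trans (cd2 _ _); rewrite ler_wpM2r // Gamma_ge0.
Qed.

End Product.

(** * Orthogonal and unitary signatures *)

Lemma isometric_signature {K : numFieldType} (cj : {rmorphism K -> K})
    {V : finType} (e : rel V) (d : nat) (s : V -> V -> 'M[K]_d) :
  (forall x y, e x y -> (s x y)^T *m map_mx cj (s x y) = 1%:M) ->
  isometric cj e s.
Proof.
move=> sE x y a b exy; rewrite /dot trmx_mul map_mxM -mulmxA.
by rewrite (mulmxA _ (map_mx _ _)) sE // mul1mx.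
Qed.

Lemma CD_product_signature {K : numFieldType} (cj : {rmorphism K -> K})
    {V1 V2 : finType} {e1 : rel V1} {e2 : rel V2} (r : nat) {d1 d2 : nat}
    (s1 : V1 -> V1 -> 'M[K]_d1) (s2 : V2 -> V2 -> 'M[K]_d2) (k k1 k2 : K) :
  (forall z, 0 <= z * cj z) -> simple_graph e1 -> simple_graph e2 ->
  isometric cj e1 s1 -> isometric cj e2 s2 -> k <= k1 -> k <= k2 ->
  CD cj e1 r s1 k1 -> CD cj e2 r s2 k2 ->
  CD cj (cartesian_edge e1 e2) (2 * r) (product_signature s1 s2) (2^-1 * k).
Proof.
move=> cj_ge0 simple1 simple2 iso1 iso2 kk1 kk2 cd1 cd2.
pose t1 x x' : 'M_(d1 * d2) := s1 x x' *t 1%:M.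
pose t2 y y' : 'M_(d1 * d2) := 1%:M *t s2 y y'.
have P1 := lslice_parseval (d1 := d1) (d2 := d2) cj.
have P2 := rslice_parseval (d1 := d1) (d2 := d2) cj.
have I1 j x x' : lslice j *m t1 x x' = s1 x x' *m lslice j.
  exact: lslice_intertwines.
have I2 i y y' : rslice i *m t2 y y' = s2 y y' *m rslice i.
  exact: rslice_intertwines.
apply: (@CD_product _ cj cj_ge0 _ _ _ _ r simple1 simple2 _ t1 t2
  _ _ _ k k1 k2) => //.
- by move=> x x' y y'; rewrite !tensmx_mul !mul1mx !mulmx1.
- exact: (isometric_intertwined P1 I1 iso1).
- exact: (isometric_intertwined P2 I2 iso2).
- exact: (CD_intertwined P1 I1).
- exact: (CD_intertwined P2 I2).
Qed.

Lemma orthogonal_isometric (R : realType) (V : finType) (e : rel V) d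
    (s : V -> V -> 'M[R]_d) :
  is_signature e (@orthogonal_group R d) s -> isometric idfun e s.
Proof.
move=> sig; apply: isometric_signature => x y /sig[/eqP sE _].
by rewrite map_mx_id //; exact: mulmx1C.
Qed.

Lemma unitary_isometric (R : realType) (V : finType) (e : rel V) d
    (s : V -> V -> 'M[R[i]]_d) :
  is_signature e (@unitary_group R d) s -> isometric Num.conj e s.
Proof.
move=> sig; apply: isometric_signature => x y /sig[/unitarymxP sE _].
move/mulmx1C: sE => /(congr1 trmx).
by rewrite trmx_mul trmx1 map_trmx trmxK.
Qed.

Theorem theorem1p5 (R : realType) (D : nat) (V1 V2 : finType)
    (e1 : rel V1) (e2 : rel V2) (d1 d2 : nat) (K1 K2 : R) :
  (1 <= D)%N ->
  simple_graph e1 -> simple_graph e2 ->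
  regular_graph e1 D -> regular_graph e2 D ->
  (forall (s1 : V1 -> V1 -> 'M[R]_d1) (s2 : V2 -> V2 -> 'M[R]_d2),
     is_signature e1 (@orthogonal_group R d1) s1 ->
     is_signature e2 (@orthogonal_group R d2) s2 ->
     CD id e1 D s1 K1 ->
     CD id e2 D s2 K2 ->
     CD id (cartesian_edge e1 e2) (2 * D) (product_signature s1 s2)
       (2^-1 * Num.min K1 K2)) /\
  (forall (s1 : V1 -> V1 -> 'M[R[i]]_d1) (s2 : V2 -> V2 -> 'M[R[i]]_d2),
     is_signature e1 (@unitary_group R d1) s1 ->
     is_signature e2 (@unitary_group R d2) s2 ->
     CD Num.conj e1 D s1 K1%:C ->
     CD Num.conj e2 D s2 K2%:C ->
     CD Num.conj (cartesian_edge e1 e2) (2 * D) (product_signature s1 s2)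
       (2^-1 * Num.min K1 K2)%:C).
Proof.
move=> _ simple1 simple2 _ _; split=> s1 s2 sig1 sig2 cd1 cd2.
- apply: (@CD_product_signature _ idfun _ _ _ _ D _ _ s1 s2 _ K1 K2) => //.
  + by move=> z; rewrite -expr2 sqr_ge0.
  + exact: orthogonal_isometric.
  + exact: orthogonal_isometric.
  + by rewrite ge_min lexx.
  + by rewrite ge_min lexx orbT.
- have -> : (2^-1 * Num.min K1 K2)%:C = 2^-1 * (Num.min K1 K2)%:C.
    by rewrite rmorphM fmorphV rmorph_nat.
  apply: (@CD_product_signature _ Num.conj _ _ _ _ D _ _ s1 s2 _ K1%:C K2%:C) => //.
  + exact: mul_conjC_ge0.
  + exact: unitary_isometric.
  + exact: unitary_isometric.
  + by rewrite lecR ge_min lexx.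
  + by rewrite lecR ge_min lexx orbT.
Qed.
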